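(* Let $(X,d)$ be a metric space. Then: (1) the upper Vietoris topology agrees with the Scott topology on $\mathsf{K}((X,d))$; (2) the Scott power space $\Sigma\,\mathsf{K}((X,d))$ is a first-countable sober space. If, in addition, $(X,d)$ is locally compact (especially, compact), then: (3) $\mathsf{K}((X,d))$ is a continuous semilattice; (4) the Scott power space $\Sigma\,\mathsf{K}((X,d))$ is a $c$-space.
   Context: For a $T_0$ space $X$, $\mathsf{K}(X)$ denotes the set of all nonempty compact saturated subsets of $X$ (saturated: intersection of open sets; in a metric space every subset is saturated), ordered by the Smyth order $K_1\sqsubseteq K_2 \iff K_2\subseteq K_1$. The upper Vietoris topology on $\mathsf{K}(X)$ has base $\{\Box U: U \text{ open in } X\}$, where $\Box U=\{K\in\mathsf{K}(X):K\subseteq U\}$. For a poset $P$, a subset $U$ is Scott open if $U$ is an upper set and for every (nonempty) directed $D\subseteq P$ whose supremum $\bigvee D$ exists in $P$, $\bigvee D\in U$ implies $D\cap U\neq\emptyset$; these sets form the Scott topology $\sigma(P)$, and $\Sigma P=(P,\sigma(P))$. The Scott power space of $X$ is $\Sigma\,\mathsf{K}(X)=(\mathsf{K}(X),\sigma(\mathsf{K}(X)))$. In a dcpo, $u\ll x$ means that for every directed $D$ with $x\le\bigvee D$ there is $d\in D$ with $u\le d$; a dcpo is a continuous domain if for each $x$ the set $\{u:u\ll x\}$ is directed with supremum $x$; a continuous semilattice is a continuous domain in which every two elements have an infimum. A space $Y$ is a $c$-space if for each $y\in Y$ and each open neighborhood $U$ of $y$ there is $u\in Y$ with $y\in\mathrm{int}\,{\uparrow}u\subseteq{\uparrow}u\subseteq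 U$, with ${\uparrow}u$ taken in the specialization order ($x\le y \iff x\in\overline{\{y\}}$). Sober: every irreducible closed subset is the closure of a unique point. *)

(* Defs.v *)
From HB Require Import structures.
From mathcomp Require Import all_boot all_order.
From mathcomp Require Import boolp classical_sets functions cardinality.
From mathcomp Require Import topology_structure compact.

Set Implicit Arguments.
Unset Strict Implicit.
Unset Printing Implicit Defensive.

Import Order.TTheory.

Local Open Scope classical_set_scope.
Local Open Scope order_scope.

Section Posets.
Context {d : Order.disp_t} {P : porderType d}.
Implicit Types (x y u : P) (D U : set P).

Definition directed D :=
  D !=set0 /\
  forall x y, D x -> D y -> exists z, [/\ D z, x <= z & y <= z].

Definition upper_set U := forall x y, x <= y -> U x -> U y.

(* [supremums D] is the set of least upper bounds of [D]: it is empty when [D]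
   has no supremum, and a singleton otherwise. *)
Definition scott_open U :=
  upper_set U /\
  forall D s, directed D -> supremums D s -> U s -> D `&` U !=set0.

Definition way_below u x :=
  forall D s, directed D -> supremums D s -> x <= s ->
  exists2 v, D v & u <= v.

Lemma scott_openT : scott_open setT.
Proof. by split=> // D s [[x Dx] _] _ _; exists x. Qed.

Lemma scott_openI : setI_closed scott_open.
Proof.
move=> U V [upU sU] [upV sV]; split.
  by move=> x y xy [Ux Vx]; split; [exact: upU Ux|exact: upV Vx].
move=> D s dD Ds [Us Vs].
have [x [Dx Ux]] := sU _ _ dD Ds Us; have [y [Dy Vy]] := sV _ _ dD Ds Vs.
have [z [Dz xz yz]] := dD.2 _ _ Dx Dy.
by exists z; split => //; split; [exact: upU Ux|exact: upV Vy].
Qed.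

Lemma scott_open_bigU (I : Type) (f : I -> set P) :
  (forall i, scott_open (f i)) -> scott_open (\bigcup_i f i).
Proof.
move=> sf; split.
  by move=> x y xy [i _ fx]; exists i => //; exact: (sf i).1 fx.
move=> D s dD Ds [i _ fs]; have [x [Dx fx]] := (sf i).2 _ _ dD Ds fs.
by exists x; split => //; exists i.
Qed.

End Posets.

Definition dcpo {d} (P : porderType d) :=
  forall D : set P, directed D -> supremums D !=set0.

Definition continuous_domain {d} (P : porderType d) :=
  dcpo P /\
  forall x : P, directed [set u | way_below u x] /\
                supremums [set u | way_below u x] x.

Definition continuous_semilattice {d} (P : porderType d) :=
  continuous_domain P /\ forall x y : P, infimums [set x; y] !=set0.

(* The space [\Sigma P]: an alias of [P] carrying the Scott topology. *)
Definition scott {d} (P : porderType d) : Type := P.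

Section ScottTopology.
Context {d : Order.disp_t} {P : porderType d}.

HB.instance Definition _ := Choice.copy (scott P) P.
HB.instance Definition _ := isOpenTopological.Build (scott P)
  (@scott_openT d P) (@scott_openI d P) (@scott_open_bigU d P).

Lemma open_scottE : @open (scott P) = @scott_open d P.
Proof. by []. Qed.

End ScottTopology.

Definition scott_topology {d} (P : porderType d) : set (set P) :=
  @open (scott P).
Arguments scott_topology {d} P.

Section Spaces.
Context {T : topologicalType}.
Implicit Types (x y u : T) (A F G U : set T).

Definition saturated A :=
  exists2 C : set (set T), C `<=` open & A = \bigcap_(U in C) U.

Definition specialization x y := closure [set y] x.

Definition up x : set T := [set y | specialization x y].

Definition irreducible A :=
  A !=set0 /\
  forall F G, closed F -> closed G -> A `<=` F `|` G -> A `<=` F \/ A `<=` G.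

End Spaces.

Definition sober (T : topologicalType) :=
  forall A : set T, closed A -> irreducible A -> exists! x, A = closure [set x].

Definition first_countable (T : topologicalType) :=
  forall x : T, exists2 B : set (set T), countable B &
    B `<=` nbhs x /\ forall U, nbhs x U -> exists2 V, B V & V `<=` U.

Definition c_space (T : topologicalType) :=
  forall (y : T) (U : set T), open_nbhs y U ->
  exists u : T, interior (up u) y /\ up u `<=` U.

Record Ksat (X : topologicalType) := MkKsat {
  Ksat_set :> set X;
  KsatP : `[< [/\ Ksat_set !=set0, compact Ksat_set & saturated Ksat_set] >]
}.

HB.instance Definition _ (X : topologicalType) := [isSub for @Ksat_set X].
HB.instance Definition _ (X : topologicalType) := [Choice of Ksat X by <:].

Fact smyth_display : Order.disp_t.
Proof. exact: Order.Disp tt tt. Qed.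

Section Smyth.
Variable X : topologicalType.
Implicit Types K : Ksat X.

Definition smyth_le K1 K2 := `[< (K2 : set X) `<=` K1 >].

Fact smyth_refl : reflexive smyth_le.
Proof. by move=> K; exact/asboolP. Qed.

Fact smyth_anti : antisymmetric smyth_le.
Proof.
by move=> K1 K2 /andP[/asboolP K21 /asboolP K12]; exact/val_inj/seteqP.
Qed.

Fact smyth_trans : transitive smyth_le.
Proof.
move=> K2 K1 K3 /asboolP K21 /asboolP K32; apply/asboolP.
exact: subset_trans K32 K21.
Qed.

HB.instance Definition _ := Order.Le_isPOrder.Build smyth_display (Ksat X)
  smyth_refl smyth_anti smyth_trans.

Lemma smyth_leE K1 K2 : (K1 <= K2) = `[< (K2 : set X) `<=` K1 >].
Proof. by []. Qed.

Definition box (U : set X) : set (Ksat X) := [set K | (K : set X) `<=` U].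

Lemma box_cover : \bigcup_(U in open) box U = setT.
Proof. by apply/seteqP; split => // K _; exists setT => //; exact: openT. Qed.

Lemma box_join (U V : set X) (K : Ksat X) :
  open U -> open V -> box U K -> box V K ->
  exists W, [/\ open W, box W K & box W `<=` box U `&` box V].
Proof.
move=> oU oV UK VK; exists (U `&` V); split; first exact: openI.
- by move=> x Kx; split; [exact: UK|exact: VK].
- by move=> L UVL; split=> x /UVL[].
Qed.

End Smyth.

(* An alias of [Ksat X] carrying the upper Vietoris topology. *)
Definition upper_vietoris (X : topologicalType) : Type := Ksat X.

Section UpperVietoris.
Variable X : topologicalType.

HB.instance Definition _ := Choice.copy (upper_vietoris X) (Ksat X).
HB.instance Definition _ := isBaseTopological.Build (upper_vietoris X)
  (@box_cover X) (@box_join X).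

Lemma open_upper_vietorisE : @open (upper_vietoris X) =
  [set \bigcup_(U in C) box U | C in subset^~ (@open X)].
Proof. by []. Qed.

End UpperVietoris.

Definition upper_vietoris_topology (X : topologicalType) : set (set (Ksat X)) :=
  @open (upper_vietoris X).
Arguments upper_vietoris_topology X : clear implicits.

(* Main.v *)
Require Import Defs.
From mathcomp Require Import all_boot all_order boolp classical_sets reals.
From mathcomp Require Import topology_structure compact metric_structure.
From mathcomp Require Import ssralg ssrnum cardinality interval_inference.
From mathcomp Require Import pseudometric_structure separation_axioms.
From mathcomp Require Import num_normedtype.

Set Implicit Arguments.
Unset Strict Implicit.
Unset Printing Implicit Defensive.

Import Order.TTheory GRing.Theory Num.Theory.

Local Open Scope classical_set_scope.

(** Only three properties of a metric space [X] matter: it is Hausdorff, each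
    of its compact subsets [K] has a sequence of neighbourhoods that eventually
    enters every neighbourhood of [K], and, for the last two claims, it is
    locally compact.

    In a Hausdorff space compact sets are closed and every set is saturated, so
    the supremum of a directed family in [Ksat X] is its intersection, and a
    directed family whose intersection lies in an open set [U] has a member in
    [U] ([directed_bigcap_sub]). Hence [Ksat X] is a dcpo and each [box U] is
    Scott open.

    Conversely let [UU] be Scott open, [K] in [UU], and [B n] a shrinking
    sequence of neighbourhoods of [K]. If no box around [K] were contained in
    [UU], each [B n] would contain a compact [C n] outside [UU]. As the [C n]
    converge to [K], each tail [L n], the union of [K] and the [C m] with
    [m >= n], is compact ([compact_bigcup_shrinking]); the [L n] decrease to
    [K], so some [L n] is in [UU], and then so is its subset [C n], which is a
    contradiction ([scott_open_sub_box]). So the two topologies agree, and the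
    boxes over the [B n] form a countable base at [K].

    For sobriety, let [A] be closed and irreducible. Irreducibility says that
    the open sets containing a member of [A] form a filter [F]. The intersection
    [Q] of their closures is compact, and a compactness argument inside a single
    member of [A] shows that every open neighbourhood of [Q] is in [F]. Hence
    [Q] lies in [A] and [A] is the closure of [Q].

    If [X] is locally compact, the compact neighbourhoods of [K] form a directed
    family with intersection [K], and they are precisely the elements way below
    [K] ([way_below_KsatP]); this gives continuity and the c-space property.
    Binary infima are unions. *)

(** * Specialization in a Scott space *)

Section ScottSpace.
Context {d : Order.disp_t} {P : porderType d}.

Lemma closure_scott1 (x : scott P) :
  closure [set x] = [set y : scott P | ((y : P) <= x)%O].
Proof.
apply/seteqP; split=> [y|y yx B]; last first.
  rewrite nbhsE => -[O [oO Oy] OB]; exists x; split=> //.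
  by apply: OB; exact: (oO : scott_open (O : set P)).1 yx Oy.
pose D : set (scott P) := [set z : scott P | ((z : P) <= x)%O].
have cD : closed D.
  rewrite -[D]setCK; apply: open_closedC; split.
    by move=> u v uv nux vx; apply: nux; exact: le_trans uv vx.
  move=> E s _ [_ sE] nsx; apply: contrapT => E0; apply: nsx; apply: sE => e Ee.
  by apply: contrapT => nex; apply: E0; exists e.
have xD : [set x] `<=` D by move=> _ ->; exact: lexx.
by rewrite closureE; apply.
Qed.

Lemma up_scottE (x : scott P) : up x = [set y : scott P | ((x : P) <= y)%O].
Proof.
by apply/seteqP; split=> y; rewrite /up /specialization /= closure_scott1.
Qed.

End ScottSpace.

(** * Compactness *)

(** The finite intersection property for a filtered family: the sets [A `&` C i]
    generate a proper filter, and its cluster points are the points sought. *)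
Lemma compact_filtered (T : topologicalType) (I : Type) (D : set I)
    (C : I -> set T) (A : set T) :
  compact A -> D !=set0 ->
  (forall i j, D i -> D j -> exists2 k, D k & C k `<=` C i `&` C j) ->
  (forall i, D i -> A `&` C i !=set0) ->
  A `&` \bigcap_(i in D) closure (C i) !=set0.
Proof.
move=> cA [i0 Di0] dirD AC.
pose F := filter_from D (fun i => A `&` C i).
have FF : ProperFilter F.
  apply: filter_from_proper => //; apply: filter_from_filter; first by exists i0.
  move=> i j Di Dj; have [k Dk kij] := dirD _ _ Di Dj; exists k => //.
  by move=> x [Ax /kij[Cix Cjx]].
have FA : F A by exists i0 => // x [].
have [x [Ax Fx]] := cA F FF FA; exists x; split=> // i Di B Bx.
have FCi : F (C i) by exists i => // y [].
exact: Fx FCi Bx.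
Qed.

(** A cluster-free compact set can be separated from the filter: each point of
    [K] leaves the closure of some member of [F], and by compactness a single
    member works for all of [K]. With [F] the neighbourhoods of a point, this
    separates points from compact sets in a Hausdorff space. *)
Lemma compact_set_nbhsC (T : topologicalType) (K : set T) (F : set_system T) :
  ProperFilter F -> compact K -> K `&` cluster F = set0 ->
  exists2 W, set_nbhs K W & F (~` W).
Proof.
move=> FF /compact_near_coveringP cK KF0.
have : \forall A \near powerset_filter_from F, K `<=` ~` closure A.
  apply: (cK _ _ (fun A x => ~ closure A x) _) => x Kx.
  have [A FA nAx] : exists2 A, F A & ~ closure A x.
    apply: contrapT => h; have : (K `&` cluster F) x; last by rewrite KF0.
    split=> //; rewrite clusterE => A FA; apply: contrapT => nAx.
    by apply: h; exists A.
  exists (~` closure A, [set B | F B /\ B `<=` A]).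
    split => /=; last exact: powerset_filter_fromP.
    apply: open_nbhs_nbhs; split=> //; apply: closed_openC.
    exact: closed_closure.
  by case=> x' B /= [nAx' [_ BA]] /(closureS BA).
move/(filterI (near_small_set FF))/filter_ex => [A [FA KA]].
exists (~` closure A).
  move=> x Kx; apply: open_nbhs_nbhs; split; last exact: KA.
  by apply: closed_openC; exact: closed_closure.
by rewrite setCK; apply: filterS FA; exact: subset_closure.
Qed.

(** The set version of the compactness of a convergent sequence with its limit:
    a filter that does not cluster in [K] avoids a neighbourhood of [K], so it
    lives on finitely many of the [C n]. *)
Lemma compact_bigcup_shrinking (T : topologicalType) (K : set T)
    (C : nat -> set T) :
  compact K -> (forall n, compact (C n)) ->
  (forall W, set_nbhs K W -> \forall n \near \oo, C n `<=` W) ->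
  compact (K `|` \bigcup_n C n).
Proof.
move=> cK cC CK F FF FL.
have [[x [Kx Fx]]|/set0P/negP/negPn/eqP KF0] :=
  pselect (K `&` cluster F !=set0); first by exists x; split=> //; left.
have [W KW FW] := compact_set_nbhsC _ cK KF0.
have [N _ CW] := CK _ KW.
have cCN : compact (\bigcup_(n in [set` iota 0 N]) C n).
  by rewrite bigcup_seq; apply: bigsetU_compact => n _; exact: cC.
have [|x [[n _ Cnx] Fx]] := cCN F FF.
  apply: filterS (filterI FL FW) => x [[Kx|[n _ Cnx]] nWx].
    by exfalso; apply: nWx; apply: nbhs_singleton; exact: KW.
  exists n => //=; rewrite mem_iota /= add0n ltnNge.
  by apply/negP => Nn; apply: nWx; exact: (CW n Nn).
by exists x; split=> //; right; exists n.
Qed.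

(** Each point of [K] has a compact neighbourhood in [U]. Applying the compactness
    of [K] to the filter of ever larger compact subsets of [U] merges finitely
    many of them. *)
Lemma locally_compact_set_nbhs (T : topologicalType) (K U : set T) :
  hausdorff_space T -> locally_compact [set: T] ->
  compact K -> set_nbhs K U ->
  exists N, [/\ compact N, set_nbhs K N & N `<=` U].
Proof.
move=> hT lT /compact_near_coveringP cK KU.
pose F := filter_from [set N | compact N /\ N `<=` U]
  (fun N => [set M | [/\ compact M, M `<=` U & N `<=` M]]).
have FF : ProperFilter F.
  apply: filter_from_proper; last by move=> N [cN NU]; exists N; split.
  apply: filter_from_filter; first by exists set0; split; [exact: compact0|].
  move=> N1 N2 [c1 U1] [c2 U2]; exists (N1 `|` N2).
    by split; [exact: compactU|rewrite subUset].
  by move=> M [cM MU]; rewrite subUset => -[].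
have : \forall M \near F, K `<=` M°.
  apply: (cK _ _ (fun M x => M° x) FF) => x Kx.
  have [B] := lT x I; rewrite withinET => Bx [cB _].
  have [C Cx CU] := compact_regular hT cB Bx (filterI (KU x Kx) Bx).
  have cC : compact (closure C).
    apply: subclosed_compact cB _; first exact: closed_closure.
    by move=> y /CU[].
  exists (C°, [set M | [/\ compact M, M `<=` U & closure C `<=` M]]).
    split => /=; first by apply: open_nbhs_nbhs; split=> //; exact: open_interior.
    by exists (closure C) => //; split=> // y /CU[].
  case=> y M /= [Cy [_ _ CM]]; apply: interiorS Cy.
  exact: subset_trans (@subset_closure _ C) CM.
have FcU : F [set M | compact M /\ M `<=` U].
  by exists set0; [split; [exact: compact0|]|move=> M []].
by move/(filterI FcU)/filter_ex => [M [[cM MU] KM]]; exists M.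
Qed.

(** * Neighbourhood sequences of compact sets *)

(** Almost all [U n] lie in [V], not just one: so any choice of subsets of the
    [U n] converges to [K], although the [U n] need not decrease. *)
Definition shrinking_base (T : topologicalType) (K : set T) (U : nat -> set T) :=
  (forall n, set_nbhs K (U n)) /\
  (forall V, set_nbhs K V -> \forall n \near \oo, U n `<=` V).

(** The witness is the sequence of [1/(n+1)]-neighbourhoods of [K]; that they
    eventually enter [V] is the positivity of the distance from a compact set to
    a disjoint closed set. *)
Lemma metric_shrinking_base (R : realType) (X : metricType R) (K : set X) :
  compact K -> exists U, shrinking_base K U.
Proof.
move=> /compact_near_coveringP cK.
exists (fun n => \bigcup_(x in K) ball x (n.+1%:R^-1)%R); split.
  move=> n x Kx; have : nbhs x (ball x (n.+1%:R^-1 : R)%R) by exact: nbhsx_ballx.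
  by apply: filterS => y xy; exists x.
move=> V KV.
suff : \forall n \near \oo, K `<=` [set x | ball x (n.+1%:R^-1 : R)%R `<=` V].
  by apply: filterS => n KnV y [x Kx]; exact: KnV.
apply: (cK _ _ (fun n x => ball x (n.+1%:R^-1 : R)%R `<=` V) _) => x Kx.
have /nbhs_ballP[e /= e0 eV] := KV x Kx.
(* Halving [e] leaves room to move the centre [x] to a nearby [x']. *)
have e20 : (0 < e / 2)%R by exact: divr_gt0.
exists (ball x (e / 2)%R, [set n | (n.+1%:R^-1 < e / 2)%R]).
  split => /=; first exact: nbhsx_ballx.
  exact: (near_infty_natSinv_lt (PosNum e20)).
case=> x' n /= [xx' ne] y x'y; apply: eV.
rewrite [e]splitr; apply: ball_triangle xx' _.
exact: le_ball (ltW ne) _ x'y.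
Qed.

(** * Compact sets in the Smyth order *)

Section SmythPowerspace.
Variable X : topologicalType.
Hypothesis hX : hausdorff_space X.
Implicit Types (K L N Q : Ksat X) (D : set (Ksat X)) (U V W : set X).

Lemma Ksat_neq0 K : (K : set X) !=set0.
Proof. by have /asboolP[] := KsatP K. Qed.

Lemma Ksat_compact K : compact (K : set X).
Proof. by have /asboolP[] := KsatP K. Qed.

Lemma Ksat_closed K : closed (K : set X).
Proof. exact: compact_closed hX (@Ksat_compact K). Qed.

Lemma smyth_leP K L : reflect ((L : set X) `<=` K) (K <= L)%O.
Proof. exact: asboolP. Qed.

Lemma open_setC1 (x : X) : open (~` [set x]).
Proof.
apply: closed_openC; apply: accessible_closed_set1.
exact: hausdorff_accessible.
Qed.

Lemma set_nbhsC1 (A : set X) x : ~ A x -> set_nbhs A (~` [set x]).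
Proof.
move=> nAx y Ay; apply: open_nbhs_nbhs; split; first exact: open_setC1.
by move=> yx; apply: nAx; rewrite -yx.
Qed.

Lemma hausdorff_saturated (A : set X) : saturated A.
Proof.
exists [set U | exists2 x, ~ A x & U = ~` [set x]].
  by move=> _ [x _ ->]; exact: open_setC1.
apply/seteqP; split=> [y Ay _ [x nAx ->] yx|y Cy].
  by apply: nAx; rewrite -yx.
by apply: contrapT => nAy; have := Cy (~` [set y]); apply=> //; exists y.
Qed.

Lemma Ksat_ex (A : set X) :
  A !=set0 -> compact A -> exists K, (K : set X) = A.
Proof.
move=> A0 cA; suff hA : `[< [/\ A !=set0, compact A & saturated A] >].
  by exists (MkKsat hA).
by apply/asboolP; split=> //; exact: hausdorff_saturated.
Qed.

(** Otherwise the members of [D] would meet the closed set [~` U], and already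
    inside one compact [K0] of [D]; by compactness so would their intersection. *)
Lemma directed_bigcap_sub D U : directed D -> open U ->
  \bigcap_(K in D) (K : set X) `<=` U -> exists2 K, D K & (K : set X) `<=` U.
Proof.
move=> [[K0 DK0] dirD] oU capU; apply: contrapT => noK.
have := @compact_filtered X (Ksat X) D (fun K => K) (K0 `&` ~` U).
case.
- by apply: compact_closedI; [exact: Ksat_compact|exact: open_closedC].
- by exists K0.
- move=> K L DK DL; have [M [DM /smyth_leP MK /smyth_leP ML]] := dirD _ _ DK DL.
  by exists M => // x Mx; split; [exact: MK|exact: ML].
- move=> K DK; have [M [DM /smyth_leP MK /smyth_leP MK0]] := dirD _ _ DK DK0.
  have [x [Mx nUx]] : (M : set X) `&` ~` U !=set0.
    apply: contrapT => h; apply: noK; exists M => // x Mx.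
    by apply: contrapT => nUx; apply: h; exists x.
  by exists x; split; [split=> //; exact: MK0|exact: MK].
move=> x [[_ nUx] Dx]; apply: nUx; apply: capU => K DK.
by have := Dx _ DK; rewrite -(closure_id _).1//; exact: Ksat_closed.
Qed.

(** The Smyth order is reverse inclusion, so suprema are intersections. *)
Lemma supremums_Ksat D K : (K : set X) = \bigcap_(L in D) (L : set X) ->
  supremums D K.
Proof.
move=> KE; split=> [L DL|M ubM]; apply/smyth_leP.
  by rewrite KE; exact: bigcap_inf.
by rewrite KE => x Mx L /ubM/smyth_leP; exact.
Qed.

(** The intersection is nonempty because no member of [D] lies in the open set
    [set0]. *)
Lemma directed_bigcap_Ksat D : directed D ->
  exists K, (K : set X) = \bigcap_(L in D) (L : set X).
Proof.
move=> dirD; apply: Ksat_ex.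
  apply: contrapT => cap0.
  have [|K _ K0] := directed_bigcap_sub dirD open0.
    by move=> x Dx; apply: cap0; exists x.
  by have [x /K0] := Ksat_neq0 K.
have [[K DK] _] := dirD; apply: subclosed_compact (@Ksat_compact K) _.
  by apply: closed_bigI => L _; exact: Ksat_closed.
exact: bigcap_inf.
Qed.

Lemma Ksat_dcpo : dcpo (Ksat X).
Proof.
by move=> D /directed_bigcap_Ksat[K /supremums_Ksat KE]; exists K.
Qed.

Lemma directed_supremum_sub D K U : directed D -> supremums D K -> open U ->
  (K : set X) `<=` U -> exists2 L, D L & (L : set X) `<=` U.
Proof.
move=> dirD DK oU KU; apply: directed_bigcap_sub => //.
have [M ME] := directed_bigcap_Ksat dirD.
by rewrite -ME -(is_subset1_supremums DK (supremums_Ksat ME)).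
Qed.

Lemma infimums_Ksat K L : infimums [set K; L] !=set0.
Proof.
have [||M ME] := @Ksat_ex (K `|` L).
- by have [x Kx] := Ksat_neq0 K; exists x; left.
- by apply: compactU; exact: Ksat_compact.
exists M; split.
  by move=> _ [->|->]; apply/smyth_leP; rewrite ME => x; [left|right].
move=> N NKL; apply/smyth_leP; rewrite ME subUset.
by split; apply/smyth_leP; apply: NKL; [left|right].
Qed.

(** * Scott open sets and boxes *)

Lemma scott_open_box U : open U -> scott_open (@box X U).
Proof.
move=> oU; split=> [K L /smyth_leP LK KU|D K dirD DK KU].
  exact: subset_trans LK KU.
by have [L DL LU] := directed_supremum_sub dirD DK oU KU; exists L.
Qed.

(** The step from Scott open to upper Vietoris open: a sequence of compact sets
    outside [UU] that converges to [K] would give, by adding [K] to its tails, a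
    directed family with supremum [K] that does not enter [UU]. *)
Lemma scott_open_sub_box (UU : set (Ksat X)) K (B : nat -> set X) :
  shrinking_base K B -> scott_open UU -> UU K ->
  exists V, [/\ open V, (K : set X) `<=` V & box V `<=` UU].
Proof.
move=> [KB BK] [upUU UUsup] UUK; apply: contrapT => noV.
have /choice[C CP] n : exists L, (L : set X) `<=` B n /\ ~ UU L.
  apply: contrapT => h.
  have /set_nbhsP[V [oV KV VB]] := KB n.
  apply: noV; exists V; split=> // L LV; apply: contrapT => nUL.
  by apply: h; exists L; split=> //; exact: subset_trans LV VB.
have CK n W : set_nbhs K W -> \forall m \near \oo, (C (m + n)%N : set X) `<=` W.
  move=> /BK[N _ BW]; exists N => // m Nm.
  apply: subset_trans (CP (m + n)%N).1 _; apply: BW => /=.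
  exact: leq_trans Nm (leq_addr _ _).
have /choice[L LE] n : exists L, (L : set X) = K `|` \bigcup_m C (m + n)%N.
  apply: Ksat_ex; first by have [x Kx] := Ksat_neq0 K; exists x; left.
  apply: compact_bigcup_shrinking (CK n); first exact: Ksat_compact.
  by move=> m; exact: Ksat_compact.
have Lmono n m : (n <= m)%N -> (L m : set X) `<=` L n.
  move=> nm; rewrite !LE => x [Kx|[k _ Cx]]; first by left.
  by right; exists (k + (m - n))%N => //; rewrite -addnA subnK.
have dirL : directed (range L).
  split; first by exists (L 0%N), 0%N.
  move=> _ _ [n _ <-] [m _ <-]; exists (L (maxn n m)); split.
  - by exists (maxn n m).
  - by apply/smyth_leP/Lmono; exact: leq_maxl.
  - by apply/smyth_leP/Lmono; exact: leq_maxr.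
have LK : supremums (range L) K.
  apply: supremums_Ksat; apply/seteqP; split.
    by move=> x Kx _ [n _ <-]; rewrite LE; left.
  move=> x Lx; apply: contrapT => nKx.
  have [n _ Cn] := CK 0%N _ (set_nbhsC1 nKx).
  have /Lx : range L (L n) by exists n.
  rewrite LE => -[//|[m _ Cmnx]].
  have := Cn (m + n)%N (leq_addl _ _); rewrite addn0 => /(_ x Cmnx).
  exact.
have [_ [[n _ <-] ULn]] := UUsup _ _ dirL LK UUK.
apply: (CP n).2; apply: upUU ULn.
apply/smyth_leP; rewrite LE => x Cx.
by right; exists 0%N.
Qed.

(** * First countability and sobriety *)

Hypothesis shrinkX : forall K : set X, compact K -> exists B, shrinking_base K B.

(** From here on Scott neighbourhoods are handled through open subsets of [X]. *)
Lemma nbhs_scott_Ksat (K : scott (Ksat X)) (UU : set (scott (Ksat X))) :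
  nbhs K UU <->
  exists V, [/\ open V, (K : Ksat X) `<=` V & box V `<=` UU].
Proof.
split=> [|[V [oV KV VU]]]; rewrite nbhsE; last first.
  by exists (box V) => //; split=> //; exact: scott_open_box.
case=> O [oO OK] OU.
have [B KB] := shrinkX (@Ksat_compact K).
have [V [oV KV VO]] := scott_open_sub_box KB oO OK.
by exists V; split=> //; exact: subset_trans VO OU.
Qed.

Lemma upper_vietoris_scott : upper_vietoris_topology X = scott_topology (Ksat X).
Proof.
apply/seteqP; split=> UU.
  rewrite /upper_vietoris_topology open_upper_vietorisE => -[C Co <-].
  apply: (@bigcup_open (scott (Ksat X))) => U CU; apply: scott_open_box.
  exact: Co.
move=> oUU; rewrite /upper_vietoris_topology open_upper_vietorisE.
exists [set V | open V /\ box V `<=` UU]; first by move=> V [].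
apply/seteqP; split=> [K [V [_ VU] KV]|K UK]; first exact: VU.
have /nbhs_scott_Ksat[V [oV KV VU]] : @nbhs _ (scott (Ksat X)) K UU.
  by apply: open_nbhs_nbhs; split.
by exists V.
Qed.

Lemma first_countable_scott_Ksat : first_countable (scott (Ksat X)).
Proof.
move=> K; have [B [KB BK]] := shrinkX (@Ksat_compact K).
exists (range (fun n => @box X (B n))).
  by apply: card_le_trans (card_image_le _ _) _; exact: countableP.
split=> [_ [n _ <-]|UU /nbhs_scott_Ksat[V [oV KV VU]]].
  have /set_nbhsP[V [oV KV VB]] := KB n.
  apply/nbhs_scott_Ksat; exists V; split=> // L LV.
  exact: subset_trans LV VB.
have [|n _ /(_ n (leqnn n)) BV] := BK V.
  by apply/set_nbhsP; exists V; split.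
exists (box (B n)); first by exists n.
by move=> L LB; apply: VU; exact: subset_trans LB BV.
Qed.

(** The generic point of [A] is the intersection of the members of [A], written
    here as the intersection of the closures of the sets in the filter [F]. The
    closures make the filter meet compact sets in closed sets, so that the
    Hofmann-Mislove property [QF] holds by plain compactness; they do no harm
    since a point outside a compact set is outside the closure of one of its
    neighbourhoods. *)
Lemma sober_scott_Ksat : sober (scott (Ksat X)).
Proof.
move=> A cA [[K0 AK0] irrA].
pose F := [set U | open U /\ exists2 K : Ksat X, A K & (K : set X) `<=` U].
have FI U V : F U -> F V -> F (U `&` V).
  move=> [oU [K AK KU]] [oV [L AL LV]]; split; first exact: openI.
  apply: contrapT => noUV.
  have cb W : open W -> closed (~` box W : set (scott (Ksat X))).
    by move=> oW; apply: open_closedC; exact: scott_open_box.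
  have [|AU|AV] := irrA _ _ (cb _ oU) (cb _ oV).
  - move=> M AM; apply: contrapT => /not_orP[/contrapT MU /contrapT MV].
    by apply: noUV; exists M => // x Mx; split; [exact: MU|exact: MV].
  - exact: AU AK KU.
  - exact: AV AL LV.
pose Qs := \bigcap_(U in F) closure U.
have QA K : A K -> Qs `<=` K.
  move=> AK x Qx; apply: contrapT => nKx.
  have KxE : K `&` cluster (nbhs x) = set0.
    apply/seteqP; split=> // y [Ky /hX xy].
    by apply: nKx; rewrite xy.
  have [W /set_nbhsP[V [oV KV VW]] xW] :=
    compact_set_nbhsC _ (@Ksat_compact K) KxE.
  have /Qx/(_ _ xW)[y [/VW Wy nWy]] : F V by split=> //; exists K.
  exact: nWy.
have QF V : open V -> Qs `<=` V -> F V.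
  move=> oV QV; apply: contrapT => nFV.
  have [||||x [[K0x nVx] Qx]] :=
    @compact_filtered X (set X) F closure (K0 `&` ~` V).
  - by apply: compact_closedI; [exact: Ksat_compact|exact: open_closedC].
  - by exists setT; split; [exact: openT|exists K0].
  - by move=> U W FU FW; exists (U `&` W); [exact: FI|exact: closureI].
  - move=> U FU; apply: contrapT => noU; apply: nFV; split=> //.
    (* The closure of [U] is disjoint from [K0 `\` V], so [K0] lies in the union
       of [V] and the exterior of [U]; the trace of this union on [U] is a
       member of [F] inside [V]. *)
    have [|_ [K AK KW]] := FI (V `|` ~` closure U) U _ FU.
      split.
        by apply: openU => //; apply: closed_openC; exact: closed_closure.
      exists K0 => // x K0x; apply: contrapT => /not_orP[nVx /contrapT cUx].
      by apply: noU; exists x.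
    exists K => // x /KW[[//|ncUx] Ux].
    by exfalso; apply: ncUx; exact: subset_closure.
  - apply: nVx; apply: QV => U /Qx.
    by rewrite -(closure_id _).1//; exact: closed_closure.
have [||Q QE] := @Ksat_ex Qs.
- apply: contrapT => Q0; have [|_ [K _ Ke]] := QF set0 open0.
    by move=> x Qx; apply: Q0; exists x.
  by have [x /Ke] := Ksat_neq0 K.
- apply: subclosed_compact (QA _ AK0); last exact: Ksat_compact.
  by apply: closed_bigI => U _; exact: closed_closure.
have AQ : A Q.
  rewrite (closure_id A).1// => UU /nbhs_scott_Ksat[V [oV QV VU]].
  have [|_ [K AK KV]] := QF V oV; first by rewrite -QE.
  by exists K; split=> //; exact: VU.
exists Q; split=> [|L AL].
  rewrite closure_scott1; apply/seteqP; split=> K.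
    by move=> AK; apply/smyth_leP; rewrite QE; exact: QA.
  move=> KQ; rewrite (closure_id A).1// => UU.
  rewrite nbhsE => -[O [oO OK] OU]; exists Q; split=> //.
  by apply: OU; exact: (oO : scott_open (O : set (Ksat X))).1 KQ OK.
have : closure [set (L : scott (Ksat X))] Q by rewrite -AL.
have : A L by rewrite AL; exact: subset_closure.
rewrite closure_scott1 /= => AL' QL.
apply: (@le_anti _ (Ksat X)); apply/andP; split=> //.
by apply/smyth_leP; rewrite QE; exact: QA.
Qed.

(** * Locally compact spaces *)

Hypothesis lX : locally_compact [set: X].

Lemma Ksat_nbhs_ex K U : set_nbhs K U ->
  exists N, set_nbhs K N /\ (N : set X) `<=` U.
Proof.
move=> KU; have [M [cM KM MU]] :=
  locally_compact_set_nbhs hX lX (@Ksat_compact K) KU.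
have [|N NE] := Ksat_ex _ cM; last by exists N; rewrite NE.
by have [x Kx] := Ksat_neq0 K; exists x; apply: nbhs_singleton; exact: KM.
Qed.

Lemma directed_Ksat_nbhs K : directed [set N : Ksat X | set_nbhs K N].
Proof.
split.
  by have [N [KN _]] := Ksat_nbhs_ex (filterT : set_nbhs K setT); exists N.
move=> N1 N2 KN1 KN2; have [N [KN]] := Ksat_nbhs_ex (filterI KN1 KN2).
by rewrite subsetI => -[N1N N2N]; exists N; split=> //; exact/smyth_leP.
Qed.

Lemma supremums_Ksat_nbhs K : supremums [set N : Ksat X | set_nbhs K N] K.
Proof.
apply: supremums_Ksat; apply/seteqP; split=> [x Kx N /(_ x Kx)|x Kx].
  exact: nbhs_singleton.
apply: contrapT => nKx.
have [N [KN Nx]] := Ksat_nbhs_ex (set_nbhsC1 nKx).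
exact: Nx (Kx N KN) _.
Qed.

(** The compact neighbourhoods of [K] form a directed family with supremum [K],
    so anything way below [K] contains one of them. *)
Lemma way_below_KsatP K L : way_below L K <-> set_nbhs K L.
Proof.
split=> [LK|/set_nbhsP[U [oU KU UL]] D M dirD DM /smyth_leP MK].
  have [N KN /smyth_leP NL] :=
    LK _ _ (directed_Ksat_nbhs K) (supremums_Ksat_nbhs K) (lexx K).
  exact: filterS NL KN.
have [N DN NU] := directed_supremum_sub dirD DM oU (subset_trans MK KU).
by exists N => //; apply/smyth_leP; exact: subset_trans NU UL.
Qed.

Lemma Ksat_continuous_semilattice : continuous_semilattice (Ksat X).
Proof.
split; last exact: infimums_Ksat.
split=> [|K]; first exact: Ksat_dcpo.
have -> : [set L | way_below L K] = [set L : Ksat X | set_nbhs K L].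
  by apply/seteqP; split=> L /way_below_KsatP.
by split; [exact: directed_Ksat_nbhs|exact: supremums_Ksat_nbhs].
Qed.

Lemma c_space_scott_Ksat : c_space (scott (Ksat X)).
Proof.
move=> K UU [oU UK].
have /nbhs_scott_Ksat[V [oV KV VU]] : nbhs K UU by exact: open_nbhs_nbhs.
have [|N [/set_nbhsP[W [oW KW WN]] NV]] := @Ksat_nbhs_ex K V.
  by apply/set_nbhsP; exists V; split.
exists N; rewrite up_scottE; split.
  apply/nbhs_scott_Ksat; exists W; split=> // L LW.
  by apply/smyth_leP; exact: subset_trans LW WN.
by move=> L /smyth_leP LN; apply: VU; exact: subset_trans LN NV.
Qed.

End SmythPowerspace.

Theorem corollary8p23 (R : realType) (X : metricType R) :
  [/\ upper_vietoris_topology X = scott_topology (Ksat X),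
      first_countable (scott (Ksat X)) /\ sober (scott (Ksat X)) &
      locally_compact [set: X] ->
      continuous_semilattice (Ksat X) /\ c_space (scott (Ksat X))].
Proof.
have hX := @metric_hausdorff R X; have sX := @metric_shrinking_base R X.
split; first exact: upper_vietoris_scott.
  by split; [exact: first_countable_scott_Ksat|exact: sober_scott_Ksat].
move=> lX; split; first exact: Ksat_continuous_semilattice.
exact: c_space_scott_Ksat.
Qed.
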